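(* Let $\Gamma$ be an abstract group, let $F$ be a field of characteristic zero, and let $\rho_1,\rho_2:\Gamma\to GL_n(F)$ be semisimple representations. Then the following are equivalent: (1) $\rho_1$ and $\rho_2$ are potentially equivalent; (2) there is a natural number $m\geq 1$ such that $\chi^{[m]}_{\rho_1}=\chi^{[m]}_{\rho_2}$, i.e. $\mathrm{Tr}(\rho_1(g^m))=\mathrm{Tr}(\rho_2(g^m))$ for all $g\in\Gamma$.
   Context: Two representations of a group are potentially equivalent if their restrictions to some subgroup of finite index are isomorphic. For a representation $\rho:\Gamma\to GL_n(F)$ and a natural number $m$, the $m$-power character of $\rho$ is the function $\chi^{[m]}_\rho:\Gamma\to F$, $g\mapsto \mathrm{Tr}(\rho(g^m))$. *)

(* Defs.v *)
From HB Require Import structures.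
From mathcomp Require Import all_boot all_order all_algebra.

Set Implicit Arguments.
Unset Strict Implicit.
Unset Printing Implicit Defensive.

Import GRing.Theory.
Local Open Scope ring_scope.

(* A representation Gamma -> GL_n(F). Matrices act on column vectors on the
   left. *)
Record mxrep (Gamma : groupType) (F : fieldType) (n : nat) := MxRep {
  mxrep_fun :> Gamma -> 'M[F]_n;
  mxrep_unit : forall g, mxrep_fun g \in unitmx;
  mxrep1 : mxrep_fun 1%g = 1%:M;
  mxrepM : forall g h, mxrep_fun (g * h)%g = mxrep_fun g *m mxrep_fun h }.

Section Representations.

Variables (Gamma : groupType) (F : fieldType) (n : nat).
Implicit Types (rho : mxrep Gamma F n) (U W : {vspace 'cV[F]_n}).
Implicit Type H : Gamma -> Prop.

Definition subrep rho U : Prop :=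
  forall (g : Gamma) (v : 'cV[F]_n), v \in U -> rho g *m v \in U.

Definition irreducible_subrep rho U : Prop :=
  [/\ subrep rho U, U != 0%VS
    & forall W, subrep rho W -> (W <= U)%VS -> W = 0%VS \/ W = U].

Definition semisimple rho : Prop :=
  exists (k : nat) (V : 'I_k -> {vspace 'cV[F]_n}),
    [/\ forall i, irreducible_subrep rho (V i),
        (\sum_(i < k) V i)%VS = fullv
      & directv (\sum_(i < k) V i)].

Definition subgroup H : Prop :=
  [/\ H 1%g, forall g h, H g -> H h -> H (g * h)%g
    & forall g, H g -> H (g^-1)%g].

(* Gamma is covered by the finitely many left cosets x H, x in s. *)
Definition finite_index H : Prop :=
  exists s : seq Gamma, forall g, exists2 x, x \in s & H (x^-1 * g)%g.

Definition isomorphic_on H rho1 rho2 : Prop :=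
  exists2 P : 'M[F]_n, P \in unitmx
    & forall h, H h -> P *m rho1 h = rho2 h *m P.

Definition potentially_equivalent rho1 rho2 : Prop :=
  exists H, [/\ subgroup H, finite_index H & isomorphic_on H rho1 rho2].

Definition power_character (m : nat) rho (g : Gamma) : F := \tr (rho (g ^+ m)%g).

End Representations.

(* Main.v *)
(**
  If [rho1] and [rho2] agree up to conjugation on a subgroup of finite index, some
  positive power of every element lies in that subgroup, so the corresponding power
  characters agree.

  Conversely, suppose that the [m]-power characters agree. Put
  [M := rho1 g (+) rho2 g] and [D := 1 (+) -1], so that [\tr (D *m M ^+ (m * i)) = 0]
  for all [i]. Let [h g] be the determinant of the differential
  [V |-> \sum_(i < m) M ^+ i * V * M ^+ (m - 1 - i)] of the [m]-th power map at [M].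
  If [h g != 0] then everything commuting with [M ^+ m] commutes with [M], and by
  duality [\tr (D *m M) = 0]. Thus [f g := \tr (rho1 g) - \tr (rho2 g)] satisfies
  [f * h = 0], while [h 1] is a power of [m], nonzero in characteristic zero. As [f]
  and [h] are matrix coefficients of one finite-dimensional representation, they
  define closed sets for a Noetherian topology on the group that is invariant under
  translations. An irreducible closed set through [1] whose stabiliser has finite
  index lies in the zero set of [f], so the characters agree on that stabiliser.

  On its normal core both representations stay semisimple by Clifford's argument, and
  have equal characters. Split off an intertwiner of maximal rank: the leftover
  summands admit no nonzero intertwiners, so by the double centralizer theorem the
  projection to the first of them is a combination of group elements. The difference
  of characters vanishes on it, so this summand has dimension zero.
*)

From HB Require Import structures.
Require Import Defs.
From mathcomp Require Import all_boot all_order all_algebra.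
From mathcomp Require Import boolp functions mxtens.

Set Implicit Arguments.
Unset Strict Implicit.
Unset Printing Implicit Defensive.

Import GRing.Theory.
Local Open Scope ring_scope.

Lemma ex_argmaxn (T : Type) (P : T -> Prop) (m : T -> nat) (b : nat) :
    (exists x, P x) -> (forall x, P x -> (m x <= b)%N) ->
  exists2 x, P x & forall y, P y -> (m y <= m x)%N.
Proof.
move=> [x0 Px0] Pb; pose Q k := `[< exists2 x, P x & m x = k >].
have exQ : exists k, Q k by exists (m x0); apply/asboolP; exists x0.
have ubQ k : Q k -> (k <= b)%N by case/asboolP=> x /Pb + <-.
case: (ex_maxnP exQ ubQ) => _ /asboolP[x Px <-] max_x; exists x => // y Py.
by apply: max_x; apply/asboolP; exists y.
Qed.

Lemma ex_argminn (T : Type) (P : T -> Prop) (m : T -> nat) :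
  (exists x, P x) -> exists2 x, P x & forall y, P y -> (m x <= m y)%N.
Proof.
move=> [x0 Px0]; pose Q k := `[< exists2 x, P x & m x = k >].
have exQ : exists k, Q k by exists (m x0); apply/asboolP; exists x0.
case: (ex_minnP exQ) => _ /asboolP[x Px <-] min_x; exists x => // y Py.
by apply: min_x; apply/asboolP; exists y.
Qed.

Section FiniteIndex.

Variable Gamma : groupType.
Implicit Types H : Gamma -> Prop.

Lemma subgroupX H g k : subgroup H -> H g -> H (g ^+ k)%g.
Proof.
move=> [Hone Hmul _] Hg; elim: k => [|k IHk]; first by rewrite expg0.
by rewrite expgS; apply: Hmul.
Qed.

Lemma finite_indexP H : subgroup H -> finite_index H <->
  exists (T : finType) (c : Gamma -> T), forall g h, c g = c h -> H (g^-1 * h)%g.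
Proof.
move=> [_ Hmul Hinv]; split=> [[s sH] | [T [c cH]]].
  have /choice[c cP] : forall g, exists x : seq_sub s, H ((val x)^-1 * g)%g.
    by move=> g; have [x xs Hx] := sH g; exists (SeqSub xs).
  exists _, c => g h eq_c; have := Hmul _ _ (Hinv _ (cP g)) (cP h).
  by rewrite eq_c invgM invgK mulgA mulgK.
have /choice[r rP] : forall t, exists r, (exists g, c g = t) -> c r = t.
  by move=> t; have [[g cg]|] := EM (exists g, c g = t); [exists g | exists 1%g].
exists [seq r t | t in T] => g; exists (r (c g)).
  by apply/mapP; exists (c g); rewrite ?mem_enum.
by apply: cH; apply: rP; exists g.
Qed.

Lemma finite_index_exponent H : subgroup H -> finite_index H ->
  exists2 m, (0 < m)%N & forall g, H (g ^+ m)%g.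
Proof.
move=> sgH /(finite_indexP sgH)[T [c cH]].
exists #|T|`!%N => [|g]; first exact: fact_gt0.
pose f (i : 'I_#|T|.+1) := c (g ^+ i)%g.
have /injectivePn[i [j neq_ij eq_f]] : ~~ injectiveb f.
  by apply/injectiveP => /leq_card; rewrite card_ord ltnn.
wlog lt_ij : i j neq_ij eq_f / (i < j)%N => [wlog_lt|].
  have /orP[lt_ij|lt_ji] : (i < j)%N || (j < i)%N by rewrite -neq_ltn.
    exact: (wlog_lt i j).
  by apply: (wlog_lt j i); rewrite // eq_sym.
have Hji : H (g ^+ (j - i))%g.
  by have := cH _ _ eq_f; rewrite -{1}(subnKC (ltnW lt_ij)) expgnDr mulKg.
have /dvdnP[k ->] : (j - i %| #|T|`!)%N.
  by rewrite dvdn_fact // subn_gt0 lt_ij -ltnS (leq_ltn_trans (leq_subr _ _)).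
by rewrite mulnC expgnA; apply: subgroupX.
Qed.

Definition conj_closed H := forall g x, H g -> H (x^-1 * g * x)%g.

Lemma normal_core H : subgroup H -> finite_index H ->
  exists K, [/\ subgroup K, finite_index K, conj_closed K & forall g, K g -> H g].
Proof.
move=> sgH fiH; have [Hone Hmul Hinv] := sgH.
pose K g := forall x, H (x^-1 * g * x)%g.
have sgK : subgroup K.
  split=> [x|g h Kg Kh x|g Kg x].
  - by rewrite mulg1 mulVg.
  - by have := Hmul _ _ (Kg x) (Kh x); rewrite !mulgA mulgK.
  - by have := Hinv _ (Kg x); rewrite !invgM invgK mulgA.
exists K; split=> // [|g x Kg y|g /(_ 1%g)]; last by rewrite invg1 mul1g mulg1.
  have [T [c cH]] := (finite_indexP sgH).1 fiH; have [s sH] := fiH.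
  apply/(finite_indexP sgK).
  exists _, (fun g => [ffun y : seq_sub s => c (g * val y)%g]) => g h eq_c x.
  have [y ys Hyx] := sH x; have /ffunP/(_ (SeqSub ys)) := eq_c.
  rewrite !ffunE => /cH Hgh; have := Hmul _ _ (Hmul _ _ (Hinv _ Hyx) Hgh) Hyx.
  by rewrite /= !invgM !invgK !mulgA !(mulgVK, mulgK).
by have := Kg (x * y)%g; rewrite invgM !mulgA.
Qed.

End FiniteIndex.

Section SemisimpleModules.

Variables (F : fieldType) (X : Type).

Section OneModule.

Variables (E : vectType F) (op : X -> 'End(E)).
Implicit Types (U W S C : {vspace E}).

Definition stable U := forall x v, v \in U -> op x v \in U.

(* The zero space is allowed, so that images of simple modules stay simple. *)
Definition simple_or_zero S :=
  stable S /\ forall W, stable W -> (W <= S)%VS -> W = 0%VS \/ W = S.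

Definition sum_of_simples U := exists2 s : seq {vspace E},
  forall S, S \in s -> simple_or_zero S & U = (\sum_(S <- s) S)%VS.

Lemma stable0 : stable 0%VS.
Proof. by move=> x v; rewrite !memv0 => /eqP->; rewrite linear0. Qed.

Lemma stable_cap U W : stable U -> stable W -> stable (U :&: W)%VS.
Proof.
move=> stU stW x v; rewrite !memv_cap => /andP[Uv Wv].
by rewrite stU ?stW.
Qed.

Lemma stable_add U W : stable U -> stable W -> stable (U + W)%VS.
Proof.
move=> stU stW x _ /memv_addP[u Uu [w Ww ->]].
by rewrite linearD memv_add ?stU ?stW.
Qed.

Lemma sum_of_simples1 S : simple_or_zero S -> sum_of_simples S.
Proof.
by exists [:: S] => [S'|]; rewrite ?big_seq1 // inE => /eqP->.
Qed.

Lemma sum_of_simples_add U W :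
  sum_of_simples U -> sum_of_simples W -> sum_of_simples (U + W)%VS.
Proof.
move=> [s sP ->] [t tP ->]; exists (s ++ t) => [S|]; last by rewrite big_cat.
by rewrite mem_cat => /orP[/sP|/tP].
Qed.

Lemma sum_of_simples_bigadd (I : finType) (U : I -> {vspace E}) :
  (forall i, sum_of_simples (U i)) -> sum_of_simples (\sum_i U i)%VS.
Proof.
move=> sU; elim/big_ind: _ => // [|W1 W2]; last exact: sum_of_simples_add.
by exists [::] => //; rewrite big_nil.
Qed.

Lemma simple_complement S W C : simple_or_zero S -> stable W -> stable C ->
    (W :&: C)%VS = 0%VS ->
  exists C', [/\ stable C', (W :&: C')%VS = 0%VS & (W + C + S <= W + C')%VS].
Proof.
move=> [stS simS] stW stC WC0; have stWC := stable_add stW stC.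
have [SWC0|SWC] := simS _ (stable_cap stS stWC) (capvSl _ _); last first.
  by exists C; split; rewrite // subv_add subvv -SWC capvSr.
exists (C + S)%VS; split; [exact: stable_add | | by rewrite addvA].
apply/eqP; rewrite -subv0; apply/subvP => w /memv_capP[Ww].
case/memv_addP=> c Cc [t St def_w].
have t0 : t = 0.
  apply/eqP; rewrite -memv0 -SWC0 memv_cap St.
  by rewrite -[t](addKr c) -def_w addrC memv_add ?memvN.
by rewrite -WC0 memv_cap Ww def_w t0 addr0.
Qed.

Lemma stable_complement W : sum_of_simples fullv -> stable W ->
  exists C, [/\ stable C, (W :&: C)%VS = 0%VS & (W + C)%VS = fullv].
Proof.
move=> [s sP full_s] stW.
suff [C [stC WC0 sWC]] : exists C, [/\ stable C, (W :&: C)%VS = 0%VS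
    & (\sum_(S <- s) S <= W + C)%VS].
  by exists C; split=> //; apply/eqP; rewrite eqEsubv subvf full_s.
elim: s sP {full_s} => [|S s IHs] sP.
  by exists 0%VS; split; rewrite ?capv0 ?big_nil ?sub0v //; apply: stable0.
have [C [stC WC0 sWC]] : exists C, [/\ stable C, (W :&: C)%VS = 0%VS
    & (\sum_(S <- s) S <= W + C)%VS].
  by apply: IHs => S' S's; apply: sP; rewrite inE S's orbT.
have [C' [stC' WC'0 sWC']] := simple_complement (sP S (mem_head _ _)) stW stC WC0.
exists C'; split=> //; apply: subv_trans sWC'.
by rewrite big_cons addvC addvS.
Qed.

Lemma stable_projection W : sum_of_simples fullv -> stable W ->
  exists p : 'End(E), [/\ forall x v, p (op x v) = op x (p v),
    forall v, p v \in W & forall v, v \in W -> p v = v].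
Proof.
move=> sE stW; have [C [stC WC0 WCf]] := stable_complement sE stW.
exists (daddv_pi W C); split=> [x v|v|v]; [|exact: memv_pi|exact: daddv_pi_id].
have /memv_addP[w Ww [c Cc ->]] : v \in (W + C)%VS by rewrite WCf memvf.
have piC u : u \in C -> daddv_pi W C u = 0.
  move=> Cu; have := @daddv_pi_add _ _ W C u WC0; rewrite WCf memvf => /(_ isT).
  rewrite (@daddv_pi_id _ _ C W) // 1?capvC // => /(canRL (addrK _)) ->.
  by rewrite subrr.
rewrite !linearD /= (piC c) // (piC (op x c)) ?stC // linear0.
by rewrite !(@daddv_pi_id _ _ W C) ?stW.
Qed.

Lemma ex_simple U : stable U -> U != 0%VS ->
  exists S, [/\ simple_or_zero S, S != 0%VS & (S <= U)%VS].
Proof.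
move=> stU nzU; pose P W := [/\ stable W, W != 0%VS & (W <= U)%VS].
have [|S [stS nzS sSU] minS] := @ex_argminn _ P (fun W => \dim W).
  by exists U.
exists S; split=> //; split=> // W stW sWS.
have [->|nzW] := eqVneq W 0%VS; [by left | right].
by apply/eqP; rewrite eqEdim sWS minS //; split=> //; apply: subv_trans sSU.
Qed.

Lemma ex_socle :
  exists2 T, sum_of_simples T & forall S, simple_or_zero S -> (S <= T)%VS.
Proof.
have [||T sT maxT] := @ex_argmaxn _ sum_of_simples (fun T => \dim T) (\dim {:E}).
- by exists 0%VS, [::] => //; rewrite big_nil.
- by move=> T _; apply/dimvS/subvf.
exists T => // S simS; apply: subv_trans (addvSr T S) _.
rewrite -(dimv_leqif_sup (addvSl T S)) eqn_leq dimvS ?addvSl //=.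
exact/maxT/sum_of_simples_add/sum_of_simples1.
Qed.

End OneModule.

Section Intertwiners.

Variables (E1 E2 : vectType F) (op1 : X -> 'End(E1)) (op2 : X -> 'End(E2)).
Variable f : 'Hom(E1, E2).
Hypothesis f_equiv : forall x v, f (op1 x v) = op2 x (f v).

Lemma stable_img U : stable op1 U -> stable op2 (f @: U)%VS.
Proof.
move=> stU x _ /memv_imgP[u Uu ->].
by rewrite -f_equiv memv_img ?stU.
Qed.

Lemma stable_preim U : stable op2 U -> stable op1 (f @^-1: U)%VS.
Proof. by move=> stU x u; rewrite -!memv_preim f_equiv; apply: stU. Qed.

Lemma simple_img S : simple_or_zero op1 S -> simple_or_zero op2 (f @: S)%VS.
Proof.
move=> [stS simS]; split=> [|W stW sWS]; first exact: stable_img.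
have def_W : W = (f @: (f @^-1: W :&: S))%VS.
  apply/eqP; rewrite eqEsubv; apply/andP; split; apply/subvP => w.
    move=> Ww; have /memv_imgP[u Su def_w] := subvP sWS _ Ww.
    by rewrite def_w memv_img // memv_cap -memv_preim -def_w Ww.
  by case/memv_imgP=> u; rewrite memv_cap -memv_preim => /andP[Wfu _] ->.
case: (simS (f @^-1: W :&: S)%VS) => [|| eqW | eqW]; rewrite ?capvSr //.
- exact/stable_cap/stS/stable_preim.
- by left; rewrite def_W eqW limg0.
by right; rewrite def_W eqW.
Qed.

Lemma sum_of_simples_img U :
  sum_of_simples op1 U -> sum_of_simples op2 (f @: U)%VS.
Proof.
move=> [s sP ->]; exists [seq (f @: V)%VS | V <- s].
  by move=> _ /mapP[V Vs ->]; apply/simple_img/sP.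
by rewrite limg_sum big_map.
Qed.

Lemma ex_intertwining_pinv :
    sum_of_simples op1 fullv -> sum_of_simples op2 fullv ->
  exists2 g : 'Hom(E2, E1), forall x v, g (op2 x v) = op1 x (g v)
    & forall v, f (g (f v)) = f v.
Proof.
move=> ssE1 ssE2.
have [|p [p_equiv p_ker p_id]] := @stable_projection _ op1 (lker f) ssE1.
  by move=> x v; rewrite !memv_ker f_equiv => /eqP->; rewrite linear0.
have [|q [q_equiv q_img q_id]] := @stable_projection _ op2 (limg f) ssE2.
  by apply: stable_img => x v _; apply: memvf.
have fK v : f (v - p v) = f v.
  by rewrite linearB /=; have := p_ker v; rewrite memv_ker => /eqP->; rewrite subr0.
have eq_f u v : f u = f v -> u - p u = v - p v.
  move=> fuv; apply/eqP; rewrite -subr_eq0 opprD addrACA -opprD -linearB /=.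
  by rewrite p_id ?subrr // memv_ker linearB /= fuv subrr.
exists ((\1 - p) \o f^-1 \o q)%VF => [x v|v];
  rewrite !(comp_lfunE, add_lfunE, opp_lfunE, id_lfunE); last first.
  by rewrite fK limg_lfunVK ?q_id ?memv_img ?memvf.
rewrite [RHS]linearB /= -p_equiv; apply: eq_f.
by rewrite f_equiv !limg_lfunVK.
Qed.

End Intertwiners.

End SemisimpleModules.

Lemma ex_vspace_pred (F : fieldType) (E : vectType F) (P : E -> Prop) : P 0 ->
    (forall a u v, P u -> P v -> P (a *: u + v)) ->
  exists U : {vspace E}, forall v, v \in U <-> P v.
Proof.
move=> P0 P_lin; pose sub (U : {vspace E}) := forall v, v \in U -> P v.
have [||U subU maxU] := @ex_argmaxn _ sub (fun U => \dim U) (\dim {:E}).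
- by exists 0%VS => v; rewrite memv0 => /eqP->.
- by move=> U _; apply/dimvS/subvf.
exists U => v; split=> [/subU // | Pv]; rewrite memvE.
apply: subv_trans (addvSr U <[v]>) _.
rewrite -(dimv_leqif_sup (addvSl U _)) eqn_leq dimvS ?addvSl //=.
apply: maxU => _ /memv_addP[u Uu [_ /vlineP[a ->] ->]].
by rewrite addrC; apply/P_lin/subU.
Qed.

Section MatrixFacts.

Variable F : fieldType.

Lemma eq_mx_cV m n (A B : 'M[F]_(m, n)) :
  (forall v : 'cV_n, A *m v = B *m v) -> A = B.
Proof.
move=> AB; apply/matrixP => i j; have /colP/(_ i) := AB (delta_mx j 0).
by rewrite -!colE !mxE.
Qed.

Lemma lfun_cVP m n (f : 'Hom('cV[F]_m, 'cV[F]_n)) :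
  exists A : 'M_(n, m), forall v, f v = A *m v.
Proof.
exists (\matrix_(i, j) f (delta_mx j 0) i 0) => v.
rewrite {1}[v]matrix_sum_delta linear_sum /=; apply/colP => i.
rewrite summxE mxE; apply: eq_bigr => j _.
by rewrite big_ord1 linearZ /= !mxE mulrC.
Qed.

Lemma matrix_sum_col m n (A : 'M[F]_(m, n)) :
  A = \sum_j col j A *m delta_mx 0 j.
Proof.
apply/matrixP => i j; rewrite summxE (bigD1 j) //= big1 => [|k neq_kj].
  by rewrite addr0 !mxE big_ord1 !mxE !eqxx mulr1.
by rewrite !mxE big_ord1 !mxE eqxx (eq_sym j) (negPf neq_kj) mulr0.
Qed.

Lemma idempotent_factor n (e : 'M[F]_n) : e *m e = e ->
  exists k (R : 'M_(n, k)) (L : 'M_(k, n)), L *m R = 1%:M /\ R *m L = e.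
Proof.
move=> ee; have RL : col_base e *m row_base e = e := mulmx_base e.
exists (\rank e), (col_base e), (row_base e); split=> //.
apply: (row_full_inj (col_base_full e)); apply: (row_free_inj (row_base_free e)).
by rewrite mulmx1 RL mulmxA RL -mulmxA RL.
Qed.

Lemma pinv_complements m n (P : 'M[F]_(m, n)) Q : P *m Q *m P = P ->
  let d := 1%:M - P *m Q in let e := 1%:M - Q *m P in
  [/\ d *m d = d, e *m e = e, d *m P = 0 & P *m e = 0].
Proof.
move=> PQP d e.
have dP : d *m P = 0 by rewrite mulmxBl mul1mx PQP subrr.
have Pe : P *m e = 0 by rewrite mulmxBr mulmx1 mulmxA PQP subrr.
split=> //; first by rewrite {2}/d mulmxBr mulmx1 mulmxA dP mul0mx subr0.
by rewrite {1}/e mulmxBl mul1mx -mulmxA Pe mulmx0 subr0.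
Qed.

End MatrixFacts.

Section MatrixRepresentations.

Variables (G : groupType) (F : fieldType).

Lemma mxmorph_unit n (tau : G -> 'M[F]_n) : tau 1%g = 1%:M ->
  (forall g h, tau (g * h)%g = tau g *m tau h) -> forall g, tau g \in unitmx.
Proof.
move=> tau1 tauM g.
by have /mulmx1_unit[] : tau g *m tau g^-1%g = 1%:M by rewrite -tauM mulgV.
Qed.

Definition mxrep_of n (tau : G -> 'M[F]_n) (tau1 : tau 1%g = 1%:M)
    (tauM : forall g h, tau (g * h)%g = tau g *m tau h) : mxrep G F n :=
  MxRep (mxmorph_unit tau1 tauM) tau1 tauM.

Lemma mxrepX n (rho : mxrep G F n) g k : rho (g ^+ k)%g = rho g ^+ k.
Proof.
elim: k => [|k IHk]; first by rewrite expg0 mxrep1.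
by rewrite expgS mxrepM IHk exprS.
Qed.

Definition rep_op n (rho : mxrep G F n) p (g : G) : 'End('M[F]_(n, p)) :=
  linfun (mulmx (rho g)).

Lemma rep_opE n (rho : mxrep G F n) p g (Y : 'M_(n, p)) :
  rep_op rho p g Y = rho g *m Y.
Proof. exact: lfunE. Qed.

Definition completely_reducible n (rho : mxrep G F n) :=
  sum_of_simples (rep_op rho 1) fullv.

Definition intertwines m n (rho : mxrep G F m) (tau : mxrep G F n)
  (A : 'M[F]_(n, m)) := forall g, A *m rho g = tau g *m A.

Section Intertwining.

Variables (m n p : nat).
Variables (rho : mxrep G F m) (tau : mxrep G F n) (sigma : mxrep G F p).

Lemma intertwines0 : intertwines rho tau 0.
Proof. by move=> g; rewrite mul0mx mulmx0. Qed.

Lemma intertwinesD A B :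
  intertwines rho tau A -> intertwines rho tau B -> intertwines rho tau (A + B).
Proof. by move=> Ai Bi g; rewrite mulmxDl mulmxDr Ai Bi. Qed.

Lemma intertwines1B A : intertwines rho rho A -> intertwines rho rho (1%:M - A).
Proof. by move=> Ai g; rewrite mulmxBl mulmxBr mul1mx mulmx1 Ai. Qed.

Lemma intertwinesM A B :
  intertwines tau sigma A -> intertwines rho tau B -> intertwines rho sigma (A *m B).
Proof. by move=> Ai Bi g; rewrite -mulmxA Bi !mulmxA Ai. Qed.

Lemma intertwines_pinv A : completely_reducible rho -> completely_reducible tau ->
  intertwines rho tau A -> exists2 B, intertwines tau rho B & A *m B *m A = A.
Proof.
move=> cr_rho cr_tau Ai.
have [|g g_equiv gP] :=
    @ex_intertwining_pinv _ _ _ _ _ _ (linfun (mulmx A)) _ cr_rho cr_tau.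
  by move=> x v; rewrite !lfunE /= !mulmxA Ai.
have [B gB] := lfun_cVP g.
exists B => [x|]; apply: eq_mx_cV => v.
  by have := g_equiv x v; rewrite !gB !rep_opE !mulmxA.
by have := gP v; rewrite !lfunE /= gB !mulmxA.
Qed.

Lemma img_sum_of_simples A : completely_reducible rho -> intertwines rho tau A ->
  sum_of_simples (rep_op tau 1) (limg (linfun (mulmx A) : 'Hom('cV_m, 'cV_n))).
Proof.
move=> cr Ai; apply: sum_of_simples_img cr => x v.
by rewrite !lfunE /= !mulmxA Ai.
Qed.

End Intertwining.

Lemma completely_reducible_quotient m n (rho : mxrep G F m) (tau : mxrep G F n) A B :
    completely_reducible rho -> intertwines rho tau A -> A *m B = 1%:M ->
  completely_reducible tau.
Proof.
move=> cr Ai AB1; have := img_sum_of_simples cr Ai.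
suff -> : limg (linfun (mulmx A) : 'Hom('cV_m, 'cV_n)) = fullv by [].
apply/eqP; rewrite eqEsubv subvf; apply/subvP => v _.
by apply/memv_imgP; exists (B *m v); rewrite ?memvf // lfunE /= mulmxA AB1 mul1mx.
Qed.

Section DirectSum.

Variables (m n : nat) (rho : mxrep G F m) (tau : mxrep G F n).

Fact dsum1 : block_mx (rho 1%g) 0 0 (tau 1%g) = 1%:M.
Proof. by rewrite !mxrep1 -scalar_mx_block. Qed.

Fact dsumM g h : block_mx (rho (g * h)%g) 0 0 (tau (g * h)%g) =
  block_mx (rho g) 0 0 (tau g) *m block_mx (rho h) 0 0 (tau h).
Proof. by rewrite mulmx_block !mul0mx !mulmx0 !addr0 !add0r !mxrepM. Qed.

Definition mxrep_dsum : mxrep G F (m + n) := mxrep_of dsum1 dsumM.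

Lemma intertwines_dsum_inl : intertwines rho mxrep_dsum (col_mx 1%:M 0).
Proof.
by move=> g; rewrite mul_col_mx mul_block_col !mul1mx !mulmx1 !mul0mx mulmx0 !addr0.
Qed.

Lemma intertwines_dsum_inr : intertwines tau mxrep_dsum (col_mx 0 1%:M).
Proof.
by move=> g; rewrite mul_col_mx mul_block_col !mul1mx !mulmx1 !mul0mx mulmx0 !add0r.
Qed.

Lemma completely_reducible_dsum :
  completely_reducible rho -> completely_reducible tau ->
  completely_reducible mxrep_dsum.
Proof.
move=> cr_rho cr_tau.
have sU := img_sum_of_simples cr_rho intertwines_dsum_inl.
have sW := img_sum_of_simples cr_tau intertwines_dsum_inr.
have := sum_of_simples_add sU sW; set U := limg _; set W := limg _.
suff -> : (U + W)%VS = fullv by [].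
apply/eqP; rewrite eqEsubv subvf; apply/subvP => v _; apply/memv_addP.
exists (col_mx (usubmx v) 0); last exists (col_mx 0 (dsubmx v)).
- apply/memv_imgP; exists (usubmx v); rewrite ?memvf // lfunE /=.
  by rewrite mul_col_mx mul1mx mul0mx.
- apply/memv_imgP; exists (dsubmx v); rewrite ?memvf // lfunE /=.
  by rewrite mul_col_mx mul1mx mul0mx.
by rewrite add_col_mx addr0 add0r vsubmxK.
Qed.

Lemma intertwines_dsum_blocks A : intertwines mxrep_dsum mxrep_dsum A ->
  intertwines tau rho (ursubmx A) /\ intertwines rho tau (dlsubmx A).
Proof.
move=> Ai; split=> g; have := Ai g; rewrite -[A]submxK /= !mulmx_block.
  by rewrite block_mxKur !mulmx0 !mul0mx !addr0 !add0r => /eq_block_mx[_ ->].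
by rewrite block_mxKdl !mulmx0 !mul0mx !addr0 !add0r => /eq_block_mx[_ _ ->].
Qed.

(* Traces against this matrix turn the direct sum into a difference of characters. *)
Definition dsum_sign : 'M[F]_(m + n) := block_mx 1%:M 0 0 (- 1%:M).

Lemma mxtrace_dsum_sign g :
  \tr (dsum_sign *m mxrep_dsum g) = \tr (rho g) - \tr (tau g).
Proof.
rewrite mulmx_block !mul0mx !mulmx0 !mul1mx mulNmx mul1mx !addr0 add0r.
by rewrite mxtrace_block raddfN.
Qed.

End DirectSum.

Section Centralizer.

Variables (n : nat) (rho : mxrep G F n).
Hypothesis cr : completely_reducible rho.

Lemma completely_reducible_amplify p : sum_of_simples (rep_op rho p) fullv.
Proof.
pose f j : 'Hom('cV[F]_n, 'M[F]_(n, p)) := linfun (mulmxr (delta_mx 0 j)).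
suff -> : fullv = (\sum_j limg (f j))%VS.
  apply: sum_of_simples_bigadd => j; apply: sum_of_simples_img cr => x v.
  by rewrite !lfunE /= mulmxA.
apply/esym/eqP; rewrite eqEsubv subvf; apply/subvP => Y _.
rewrite [Y]matrix_sum_col; apply: memv_sumr => j _; apply/memv_imgP.
by exists (col j Y); rewrite ?memvf // lfunE.
Qed.

(* Slicing [p] by columns of the source and of the target gives self-intertwiners
   of [rho], with which [C] commutes. *)
Lemma equivariant_mulmxl (p : 'End('M[F]_n)) C :
    (forall g Y, p (rho g *m Y) = rho g *m p Y) ->
    (forall A, intertwines rho rho A -> C *m A = A *m C) ->
  forall Y, p (C *m Y) = C *m p Y.
Proof.
move=> p_equiv C_comm Y; apply: eq_mx_cV => w.
rewrite [Y]matrix_sum_col mulmx_sumr !linear_sum /= !mulmx_suml.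
apply: eq_bigr => j _; rewrite mulmxA.
pose f : 'End('cV[F]_n) :=
  (linfun (mulmxr w) \o p \o linfun (mulmxr (delta_mx 0 j)))%VF.
have fE v : f v = p (v *m delta_mx 0 j) *m w by rewrite !comp_lfunE !lfunE.
have [A fA] := lfun_cVP f.
have /C_comm CA : intertwines rho rho A.
  by move=> g; apply: eq_mx_cV => v; rewrite -!mulmxA -!fA !fE -mulmxA p_equiv mulmxA.
by rewrite -fE fA mulmxA -CA -!mulmxA -fA fE.
Qed.

Lemma double_centralizer (B : {vspace 'M[F]_n}) C : 1%:M \in B ->
    (forall g Y, Y \in B -> rho g *m Y \in B) ->
    (forall A, intertwines rho rho A -> C *m A = A *m C) ->
  C \in B.
Proof.
move=> B1 BM C_comm; have [|p [p_equiv pB p_id]] :=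
    @stable_projection _ _ _ _ B (completely_reducible_amplify n).
  by move=> g Y /(BM g); rewrite rep_opE.
have <- : p C = C.
  rewrite -[C in p C]mulmx1 equivariant_mulmxl ?p_id ?mulmx1 // => g Y.
  by rewrite -!rep_opE p_equiv.
exact: pB.
Qed.

End Centralizer.

Lemma idempotent_subrep n (rho : mxrep G F n) e :
    e *m e = e -> intertwines rho rho e ->
  exists k (sub : mxrep G F k) (R : 'M_(n, k)) (L : 'M_(k, n)),
    [/\ L *m R = 1%:M, R *m L = e, intertwines rho sub L & intertwines sub rho R].
Proof.
move=> ee ei; have [k [R [L [LR RL]]]] := idempotent_factor ee.
have eR : e *m R = R by rewrite -RL -mulmxA LR mulmx1.
have Le : L *m e = L by rewrite -RL mulmxA LR mul1mx.
have Li g : L *m rho g = L *m rho g *m R *m L.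
  by rewrite -!mulmxA RL -ei mulmxA Le.
have Ri g : rho g *m R = R *m (L *m rho g *m R).
  by rewrite !mulmxA RL ei -mulmxA eR.
have sub1 : L *m rho 1%g *m R = 1%:M by rewrite mxrep1 mulmx1.
have subM g h : L *m rho (g * h)%g *m R = (L *m rho g *m R) *m (L *m rho h *m R).
  by rewrite mxrepM !mulmxA -Li.
by exists k, (mxrep_of sub1 subM), R, L; split=> // g /=; rewrite -?Li -?Ri.
Qed.

Lemma mxtrace_retract m n (rho : mxrep G F m) (tau : mxrep G F n) R L g :
  intertwines rho tau L -> L *m R = 1%:M -> \tr (tau g) = \tr (R *m L *m rho g).
Proof. by move=> Li LR; rewrite -mulmxA Li mxtrace_mulC -mulmxA LR mulmx1. Qed.

Lemma max_rank_intertwiner m n (rho : mxrep G F m) (tau : mxrep G F n) :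
    completely_reducible rho -> completely_reducible tau ->
  exists P Q, [/\ intertwines rho tau P, intertwines tau rho Q, P *m Q *m P = P
    & forall A, intertwines rho tau A -> (1%:M - P *m Q) *m A *m (1%:M - Q *m P) = 0].
Proof.
move=> cr_rho cr_tau.
have [||P Pi maxP] := @ex_argmaxn _ (intertwines rho tau) (fun P => \rank P) n.
- by exists 0; apply: intertwines0.
- by move=> P _; apply: rank_leq_row.
have [Q Qi PQP] := intertwines_pinv cr_rho cr_tau Pi; exists P, Q; split=> // A Ai.
have [dd _ dP _] := pinv_complements PQP.
set d := 1%:M - P *m Q in dd dP *; set e := 1%:M - Q *m P; set B := d *m A *m e.
have PBi : intertwines rho tau (P + B).
  apply/(intertwinesD Pi)/intertwinesM; first apply: intertwinesM Ai.
    exact/intertwines1B/(intertwinesM Pi).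
  exact/intertwines1B/(intertwinesM Qi).
have defP : P = (P + B) *m (Q *m P).
  have eQP : e *m (Q *m P) = 0 by rewrite mulmxBl mul1mx -mulmxA (mulmxA P) PQP subrr.
  by rewrite mulmxDl mulmxA PQP -[B *m _]mulmxA eQP mulmx0 addr0.
have sP : (P^T <= (P + B)^T)%MS by rewrite {1}defP trmx_mul submxMl.
have : (((P + B)^T) <= P^T)%MS.
  by rewrite -(mxrank_leqif_sup sP) eqn_leq mxrankS //= !mxrank_tr maxP.
case/submxP=> Z /(congr1 trmx); rewrite trmx_mul !trmxK => PB.
have := congr1 (mulmx d) PB; rewrite mulmxDr dP add0r (mulmxA d P) dP mul0mx.
by rewrite /B !mulmxA dd.
Qed.

Lemma disjoint_intertwines_sym m n (rho : mxrep G F m) (tau : mxrep G F n) :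
    completely_reducible rho -> completely_reducible tau ->
    (forall A, intertwines rho tau A -> A = 0) ->
  forall A, intertwines tau rho A -> A = 0.
Proof.
move=> cr_rho cr_tau disj A /(intertwines_pinv cr_tau cr_rho)[B /disj-> <-].
by rewrite mulmx0 mul0mx.
Qed.

Section Characters.

Hypothesis charF0 : [pchar F] =i pred0.

(* Without intertwiners the projection to the first summand is in the double
   centralizer of the direct sum, hence is a combination of group elements. *)
Lemma dim0_of_disjoint_equal_characters m n (rho : mxrep G F m) (tau : mxrep G F n) :
    completely_reducible rho -> completely_reducible tau ->
    (forall A, intertwines rho tau A -> A = 0) ->
    (forall g, \tr (rho g) = \tr (tau g)) ->
  m = 0%N.
Proof.
move=> cr_rho cr_tau no_rho_tau eq_tr.
have no_tau_rho := disjoint_intertwines_sym cr_rho cr_tau no_rho_tau.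
pose t := mxrep_dsum rho tau; pose D := @dsum_sign m n.
pose P Y := forall g, \tr (D *m t g *m Y) = 0.
have [||U UP] := @ex_vspace_pred _ _ P.
- by move=> g; rewrite mulmx0 mxtrace0.
- by move=> a Y Z YP ZP g; rewrite mulmxDr -scalemxAr linearP /= YP ZP mulr0 addr0.
pose pr1 : 'M[F]_(m + n) := block_mx 1%:M 0 0 0.
have /UP/(_ 1%g) : pr1 \in U.
  apply: (double_centralizer (completely_reducible_dsum cr_rho cr_tau)).
  - by apply/UP => g; rewrite mulmx1 mxtrace_dsum_sign eq_tr subrr.
  - by move=> g Y /UP YP; apply/UP => h; rewrite mulmxA -(mulmxA D) -mxrepM YP.
  - move=> A /intertwines_dsum_blocks[/no_tau_rho ur0 /no_rho_tau dl0].
    rewrite -[A]submxK ur0 dl0 !mulmx_block.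
    by rewrite !mulmx0 !mul0mx !addr0 mul1mx mulmx1.
rewrite mxrep1 mulmx1 mulmx_block !mul1mx !mulmx0 !mul0mx !addr0 mxtrace_block.
rewrite mxtrace1 mxtrace0 addr0 => /eqP.
by rewrite ((pcharf0P F).1 charF0) => /eqP.
Qed.

Lemma isomorphic_of_equal_characters n (rho tau : mxrep G F n) :
    completely_reducible rho -> completely_reducible tau ->
    (forall g, \tr (rho g) = \tr (tau g)) ->
  exists2 P, P \in unitmx & intertwines rho tau P.
Proof.
move=> cr_rho cr_tau eq_tr.
have [P [Q [Pi Qi PQP corner0]]] := max_rank_intertwiner cr_rho cr_tau.
have [dd ee _ _] := pinv_complements PQP.
have di : intertwines tau tau (1%:M - P *m Q).
  exact/intertwines1B/(intertwinesM Pi).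
have ei : intertwines rho rho (1%:M - Q *m P).
  exact/intertwines1B/(intertwinesM Qi).
have [k [rho_e [Re [Le [LRe RLe Lei Rei]]]]] := idempotent_subrep ee ei.
have [l [tau_d [Rd [Ld [LRd RLd Ldi Rdi]]]]] := idempotent_subrep dd di.
have disjoint A : intertwines rho_e tau_d A -> A = 0.
  move=> Ai; have := corner0 _ (intertwinesM Rdi (intertwinesM Ai Lei)).
  rewrite -RLe -RLd => /(congr1 (fun Y => Ld *m Y *m Re)).
  by rewrite mulmx0 mul0mx !mulmxA LRd mul1mx LRd mul1mx -!mulmxA !(LRe, mulmx1).
have eq_tr_sub g : \tr (rho_e g) = \tr (tau_d g).
  rewrite (mxtrace_retract _ Lei LRe) (mxtrace_retract _ Ldi LRd) RLe RLd.
  rewrite !mulmxBl !mul1mx !raddfB /= eq_tr; congr (_ - _).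
  by rewrite -mulmxA Pi mulmxA mxtrace_mulC mulmxA.
have k0 : k = 0%N.
  apply: dim0_of_disjoint_equal_characters disjoint eq_tr_sub.
  - exact: completely_reducible_quotient cr_rho Lei LRe.
  - exact: completely_reducible_quotient cr_tau Ldi LRd.
exists P => //; have [|//] := @mulmx1_unit _ _ Q P.
apply/esym/eqP; rewrite -subr_eq0 -RLe; apply/eqP/matrixP => i j.
by rewrite !mxE big1 // => x; have := ltn_ord x; rewrite {2}k0.
Qed.

End Characters.

End MatrixRepresentations.

Section Translates.

Variables (G : groupType) (F : fieldType) (n : nat) (rho : mxrep G F n).
Implicit Types (g h : G) (U W : {vspace 'cV[F]_n}).

Definition translate g U : {vspace 'cV[F]_n} := (rep_op rho 1 g @: U)%VS.

Lemma memv_translate g U v : v \in U -> rho g *m v \in translate g U.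
Proof. by rewrite -rep_opE; apply: memv_img. Qed.

Lemma translateM g h U : translate (g * h)%g U = translate g (translate h U).
Proof.
rewrite /translate -limg_comp; congr lfun_img; apply/lfunP => w.
by rewrite comp_lfunE !rep_opE mxrepM mulmxA.
Qed.

Lemma translate1 U : translate 1%g U = U.
Proof.
rewrite /translate -[RHS]lim1g; congr lfun_img; apply/lfunP => w.
by rewrite rep_opE mxrep1 mul1mx id_lfunE.
Qed.

Lemma translateK g U : translate g^-1%g (translate g U) = U.
Proof. by rewrite -translateM mulVg translate1. Qed.

Lemma translateKV g U : translate g (translate g^-1%g U) = U.
Proof. by rewrite -translateM mulgV translate1. Qed.

Lemma dim_translate g U : \dim (translate g U) = \dim U.
Proof.
apply: limg_dim_eq; apply/eqP; rewrite -subv0; apply/subvP => w.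
rewrite memv_cap memv_ker rep_opE memv0 => /andP[_ /eqP tw0].
by rewrite -(mulKmx (mxrep_unit rho g) w) tw0 mulmx0.
Qed.

Lemma translate_fixed_subgroup U : subgroup (fun g => translate g U = U).
Proof.
split=> [|g h Ug Uh|g Ug]; first exact: translate1.
  by rewrite translateM Uh.
by rewrite -{1}Ug translateK.
Qed.

Lemma translate_fixed_finite_index U (s : seq {vspace 'cV[F]_n}) :
  (forall g, translate g U \in s) -> finite_index (fun g => translate g U = U).
Proof.
move=> orbit; apply/(finite_indexP (translate_fixed_subgroup U)).
exists _, (fun g => SeqSub (orbit g)) => g h [eq_gh].
by rewrite translateM -eq_gh translateK.
Qed.

End Translates.

Section Restriction.

Variables (Gamma : groupType) (H : Gamma -> Prop) (sgH : subgroup H).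

(* The subgroup proof is an argument so that the group structure can be inferred. *)
Definition subg_of of subgroup H : Type := {g : Gamma | g \in [pred g | `[< H g >]]}.

Fact subg_closed : group_closed [pred g | `[< H g >]].
Proof.
have [Hone Hmul Hinv] := sgH.
by split=> [|g h /asboolP Hg /asboolP Hh]; apply/asboolP => //; apply/Hmul/Hinv.
Qed.

HB.instance Definition _ := SubChoice.on (subg_of sgH).
HB.instance Definition _ :=
  SubChoice_isSubGroup.Build _ _ (subg_of sgH) subg_closed.

Definition subg_in g (Hg : H g) : subg_of sgH := exist _ g (asboolT Hg).

Lemma subg_ofP (h : subg_of sgH) : H (val h).
Proof. exact/asboolP/(valP h). Qed.

Variables (F : fieldType) (n : nat) (rho : mxrep Gamma F n).

Fact restrict1 : rho (val (1%g : subg_of sgH)) = 1%:M.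
Proof. by rewrite val1 mxrep1. Qed.

Fact restrictM (g h : subg_of sgH) : rho (val (g * h)%g) = rho (val g) *m rho (val h).
Proof. by rewrite valM mxrepM. Qed.

Definition restrict : mxrep (subg_of sgH) F n :=
  mxrep_of (tau := fun h => rho (val h)) restrict1 restrictM.

Local Notation op := (rep_op restrict 1).
Hypothesis nH : conj_closed H.

Lemma stable_translate g U : stable op U -> stable op (translate rho g U).
Proof.
move=> stU h _ /memv_imgP[u Uu ->].
have := stU (subg_in (nH g (subg_ofP h))) u Uu; rewrite !rep_opE /= => Uhu.
have := memv_translate rho g Uhu.
by rewrite !mulmxA -!mxrepM !mulgA mulgV mul1g.
Qed.

Lemma simple_translate g S :
  simple_or_zero op S -> simple_or_zero op (translate rho g S).
Proof.
move=> [stS simS]; split=> [|W stW sWS]; first exact: stable_translate.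
case: (simS (translate rho g^-1 W)) => [||W0|WS].
- exact: stable_translate.
- by rewrite -[S](translateK rho g) limgS.
- by left; rewrite -[W](translateKV rho g) W0; apply: limg0.
- by right; rewrite -WS translateKV.
Qed.

(* The socle of the restriction is invariant under the whole group and meets every
   irreducible summand, hence contains it. *)
Lemma clifford : semisimple rho -> completely_reducible restrict.
Proof.
move=> [k [V [irrV sumV _]]]; have [T sT maxT] := ex_socle op.
suff fullT : fullv = T by rewrite /completely_reducible fullT.
have rhoT : subrep rho T.
  move=> g v /(memv_translate rho g); apply: subvP; case: sT => s sP defT.
  rewrite {1}defT /translate limg_sum big_seq.
  elim/big_ind: _ => [|U W sU sW|S /sP simS].
  - exact: sub0v.
  - by rewrite subv_add sU.
  - exact/maxT/simple_translate.
apply/eqP; rewrite eqEsubv subvf andbT -sumV; apply/subv_sumP => i _.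
have [rhoV nzV irrVi] := irrV i.
have [|S [simS nzS sSV]] := @ex_simple _ _ _ op (V i) _ nzV.
  by move=> h v; rewrite rep_opE; apply: rhoV.
have [|TV0|TV] := irrVi (T :&: V i)%VS _ (capvSr _ _).
- by move=> g v; rewrite !memv_cap => /andP[/rhoT-> /rhoV->].
- by case/negP: nzS; rewrite -subv0 -TV0 subv_cap sSV maxT.
by rewrite -TV capvSl.
Qed.

End Restriction.

Section IrreducibleClosedSets.

(* The subspace [U] stands for the set of all [x] with [phi x \in U]; these sets
   generate the closed sets of a Noetherian topology on [T]. *)
Variables (T : Type) (F : fieldType) (E : vectType F) (phi : T -> E).
Implicit Types (U W M : {vspace E}) (s t : seq {vspace E}).

Definition covers s U := forall x, phi x \in U -> exists2 W, W \in s & phi x \in W.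

(* Covers by the empty list are included, so irreducible sets have points. *)
Definition irreducible_closed U :=
  forall s, covers s U -> exists2 W, W \in s & (U <= W)%VS.

Lemma irreducible_point U : irreducible_closed U -> exists x, phi x \in U.
Proof.
move=> irrU; apply: contrapT => no; have [x Ux|//] := irrU [::].
by case: no; exists x.
Qed.

Lemma irreducible_decomposition U :
  exists2 s, covers s U & forall M, M \in s -> irreducible_closed M.
Proof.
have [d] := ubnP (\dim U); elim: d U => // d IHd U ltUd.
have [irrU|/existsNP[t /not_implyP[cov_t no_t]]] := EM (irreducible_closed U).
  exists [:: U] => [x Ux|M]; last by rewrite inE => /eqP->.
  by exists U; rewrite ?mem_head.
have /choice[dec decP] : forall W, exists s, W \in t ->
    covers s (U :&: W) /\ forall M, M \in s -> irreducible_closed M.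
  move=> W; have [Wt|] := boolP (W \in t); last by exists [::].
  have [|s cov_s irr_s] := IHd (U :&: W)%VS; last by exists s.
  rewrite -ltnS (leq_trans _ ltUd) // ltnS ltn_neqAle dimvS ?capvSl // andbT.
  rewrite (dimv_leqif_eq (capvSl U W)); apply/eqP => UW.
  by apply: no_t; exists W; rewrite // -UW capvSr.
exists (flatten [seq dec W | W <- t]) => [x Ux|M /flatten_mapP[W Wt]]; last first.
  by apply: (decP W Wt).2.
have [W Wt Wx] := cov_t x Ux; have [|M Ms Mx] := (decP W Wt).1 x.
  by rewrite memv_cap Ux.
by exists M => //; apply/flatten_mapP; exists W.
Qed.

End IrreducibleClosedSets.

Section Orbit.

Variables (G : groupType) (F : fieldType) (n : nat).
Variables (rho : mxrep G F n) (v : 'cV[F]_n).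
Implicit Types (U M : {vspace 'cV[F]_n}).

Local Notation phi := (fun g => rho g *m v).

Lemma irreducible_translate g U :
  irreducible_closed phi U -> irreducible_closed phi (translate rho g U).
Proof.
move=> irrU s cov.
have [|_ /mapP[W Ws ->] sUW] := irrU [seq translate rho g^-1%g V | V <- s].
  move=> x /(memv_translate rho g); rewrite mulmxA -mxrepM => /cov[W Ws].
  move/(memv_translate rho g^-1%g); rewrite mulmxA -mxrepM mulKg => Wx.
  by exists (translate rho g^-1%g W); rewrite ?map_f.
by exists W; rewrite // -[W](translateKV rho g) limgS.
Qed.

(* A largest member of a decomposition into irreducible sets has all its
   translates in that decomposition, so its stabiliser has finite index. *)
Lemma ex_finite_index_irreducible : exists M (H : G -> Prop),
  [/\ irreducible_closed phi M, subgroup H, finite_index H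
    & forall h, H h -> phi h \in M].
Proof.
have [s cov_s irr_s] := irreducible_decomposition phi fullv.
have [||M Ms maxM] :=
    @ex_argmaxn _ (fun M => M \in s) (fun M => \dim M) (\dim {:'cV[F]_n}).
- by have [M Ms _] := cov_s 1%g (memvf _); exists M.
- by move=> M _; apply/dimvS/subvf.
have irrM := irr_s _ Ms.
have trM g : translate rho g M \in s.
  have [x _|U Us sMU] := irreducible_translate (g := g) irrM (s := s).
    exact/cov_s/memvf.
  suff -> : translate rho g M = U by [].
  by apply/eqP; rewrite eqEdim sMU dim_translate maxM.
have [x Mx] := irreducible_point irrM.
pose N := translate rho x^-1%g M; pose H h := translate rho h N = N.
exists N, H; split=> [|||h Hh].
- exact: irreducible_translate.
- exact: translate_fixed_subgroup.
- by apply: (translate_fixed_finite_index (s := s)) => g; rewrite -translateM.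
have := memv_translate rho h (memv_translate rho x^-1%g Mx).
by rewrite -/N Hh (mulmxA _ (rho x)) -mxrepM mulVg mxrep1 mul1mx.
Qed.

End Orbit.

Section RepresentativeFunctions.

Variables (G : groupType) (F : fieldType).
Implicit Types f h : G -> F.

Definition is_repfun f := exists n (rho : mxrep G F n) (u : 'rV_n) (v : 'cV_n),
  forall g, f g = (u *m rho g *m v) 0 0.

Definition repfun : {pred G -> F} := fun f => `[< is_repfun f >].

Lemma repfunP f : reflect (is_repfun f) (f \in repfun).
Proof. exact: asboolP. Qed.

Lemma repfun_entry n (rho : mxrep G F n) i j : (fun g => rho g i j) \in repfun.
Proof.
apply/repfunP; exists n, rho, (delta_mx 0 i), (delta_mx j 0) => g.
by rewrite -rowE -colE !mxE.
Qed.

Lemma repfun_pair f h : f \in repfun -> h \in repfun ->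
  exists n (rho : mxrep G F n) (u w : 'rV_n) (v : 'cV_n),
    forall g, f g = (u *m rho g *m v) 0 0 /\ h g = (w *m rho g *m v) 0 0.
Proof.
move=> /repfunP[m [rho [u [v fE]]]] /repfunP[n [tau [w [z hE]]]].
exists _, (mxrep_dsum rho tau), (row_mx u 0), (row_mx 0 w), (col_mx v z) => g.
rewrite /= !mul_row_block !mul0mx !mulmx0 !addr0 !add0r !mul_row_col.
by rewrite !mul0mx addr0 add0r.
Qed.

Section TensorProduct.

Variables (m n : nat) (rho : mxrep G F m) (tau : mxrep G F n).

Fact tens1 : rho 1%g *t tau 1%g = 1%:M.
Proof.
rewrite !mxrep1; apply/matrixP => i j.
case: (mxtens_indexP i) => i1 i2; case: (mxtens_indexP j) => j1 j2.
rewrite tensmxE !mxE (inj_eq (can_inj (@mxtens_indexK _ _))) xpair_eqE.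
by rewrite -natrM mulnb.
Qed.

Fact tensM (x y : G) : rho (x * y)%g *t tau (x * y)%g =
  (rho x *t tau x) *m (rho y *t tau y).
Proof. by rewrite !mxrepM tensmx_mul. Qed.

Definition mxrep_tens : mxrep G F (m * n) :=
  mxrep_of (tau := fun g => rho g *t tau g) tens1 tensM.

End TensorProduct.

Fact repfun_subring_closed : subring_closed repfun.
Proof.
split=> [|f h Rf Rh|f h].
- have triv1 : 1%:M = 1%:M :> 'M[F]_1 by [].
  have trivM (g h : G) : 1%:M = 1%:M *m 1%:M :> 'M[F]_1 by rewrite mulmx1.
  apply/repfunP; exists _, (mxrep_of (tau := fun=> 1%:M) triv1 trivM), 1%:M, 1%:M => g.
  by rewrite !mulmx1 mxE.
- have [n [rho [u [w [v E]]]]] := repfun_pair Rf Rh.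
  apply/repfunP; exists n, rho, (u - w), v => g.
  by have [fE hE] := E g; rewrite addrfctE opprfctE fE hE !mulmxBl !mxE.
move=> /repfunP[m [rho [u [v fE]]]] /repfunP[n [tau [w [z hE]]]].
apply/repfunP; exists _, (mxrep_tens rho tau), (u *t w), (v *t z) => g /=.
rewrite mulrfctE fE hE -tensmxE -!tensmx_mul.
by congr (fun_of_matrix _ _ _); apply: val_inj.
Qed.

HB.instance Definition _ := GRing.isSubringClosed.Build (G -> F) repfun
  repfun_subring_closed.

Lemma repfun_mul_eq0 f h : f \in repfun -> h \in repfun ->
    (forall g, f g * h g = 0) -> h 1%g != 0 ->
  exists H : G -> Prop, [/\ subgroup H, finite_index H & forall x, H x -> f x = 0].
Proof.
move=> Rf Rh fh0 h1; have [n [rho [u [w [v E]]]]] := repfun_pair Rf Rh.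
have [M [H [irrM sgH fiH HM]]] := ex_finite_index_irreducible rho v.
have [Hone _ _] := sgH.
pose Z (z : 'rV[F]_n) := lker (linfun (mulmx z) : 'Hom('cV_n, 'M_1)).
have ZE z x : (rho x *m v \in Z z) = ((z *m rho x *m v) 0 0 == 0).
  by rewrite memv_ker lfunE /= mulmxA [_ *m v]mx11_scalar fmorph_eq0 !mxE.
exists H; split=> // x Hx; have [fx hx] := E x.
have [y _|W] := irrM [:: Z u; Z w].
  have := fh0 y; have [-> ->] := E y => /eqP.
  rewrite mulf_eq0 -!ZE => /orP[]Zy; [exists (Z u) | exists (Z w)] => //.
    by rewrite mem_head.
  by rewrite inE mem_head orbT.
rewrite !inE => /orP[]/eqP-> /subvP sM.
  by apply/eqP; rewrite fx -ZE; apply/sM/HM.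
by case/negP: h1; have [_ ->] := E 1%g; rewrite -ZE; apply/sM/HM.
Qed.

End RepresentativeFunctions.

Arguments repfun {G F}.

Section PowerDifferential.

Variable R : pzRingType.
Implicit Types x y v : R.

(* The differential of [x |-> x ^+ k] at [x] in the direction [v]. *)
Definition dpow k x v := \sum_(i < k) x ^+ i * v * x ^+ (k.-1 - i).

Lemma dpowS k x v : dpow k.+1 x v = dpow k x v * x + x ^+ k * v.
Proof.
rewrite /dpow big_ord_recr /= subnn expr0 mulr1 mulr_suml; congr (_ + _).
apply: eq_bigr => i _; rewrite -[RHS]mulrA -exprSr.
case: k i => [|k] i; first by case: i.
by rewrite subSn // -ltnS ltn_ord.
Qed.

Lemma dpow_commutator k x v :
  x * dpow k x v - dpow k x v * x = x ^+ k * v - v * x ^+ k.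
Proof.
elim: k => [|k IHk]; first by rewrite /dpow big_ord0 mulr0 mul0r mul1r mulr1 !subrr.
rewrite dpowS mulrDr mulrDl opprD addrACA !mulrA -mulrBl IHk mulrBl -exprS.
by rewrite -(mulrA v) -exprSr addrC addrA subrK.
Qed.

Lemma dpow_of_commutator k x v :
  dpow k x (x * v - v * x) = x ^+ k * v - v * x ^+ k.
Proof.
elim: k => [|k IHk]; first by rewrite /dpow big_ord0 mul1r mulr1 subrr.
rewrite dpowS IHk mulrBl mulrBr !mulrA -exprSr -(mulrA v) -exprSr.
by rewrite addrC addrA subrK.
Qed.

Lemma comm_of_commX k x y : (forall v, dpow k x v = 0 -> v = 0) ->
  GRing.comm (x ^+ k) y -> GRing.comm x y.
Proof.
move=> inj xk_y; apply/eqP; rewrite -subr_eq0; apply/eqP/inj.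
by rewrite dpow_of_commutator xk_y subrr.
Qed.

Lemma dpow1 k v : dpow k 1 v = v *+ k.
Proof.
rewrite /dpow (eq_bigr (fun=> v)) ?sumr_const ?card_ord // => i _.
by rewrite !expr1n mul1r mulr1.
Qed.

End PowerDifferential.

Lemma rmorph_dpow (R S : pzRingType) (f : {rmorphism R -> S}) k x v :
  f (dpow k x v) = dpow k (f x) (f v).
Proof.
by rewrite rmorph_sum; apply: eq_bigr => i _; rewrite !rmorphM !rmorphXn.
Qed.

Definition dpow_det (R : pzRingType) n k (M : 'M[R]_n) : R := \det (lin_mx (dpow k M)).

Lemma map_dpow_det (R S : pzRingType) (f : {rmorphism R -> S}) n k (M : 'M[R]_n) :
  dpow_det k (map_mx f M) = f (dpow_det k M).
Proof.
rewrite -det_map_mx; congr (\det _); apply/esym/map_lin_mx => V.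
exact: (rmorph_dpow (map_mx f)).
Qed.

Lemma rpred_dpow_det (R : pzRingType) (S : subringClosed R) n k (M : 'M[R]_n) :
  M \is a mxOver S -> dpow_det k M \in S.
Proof.
move=> SM; have lin_in i j : lin_mx (dpow k M) i j \in S.
  case/mxvec_indexP: i => i1 i2; case/mxvec_indexP: j => j1 j2.
  rewrite mxE /= vec_mx_delta mxvecE; apply/mxOverP/rpred_sum => i _.
  rewrite !rpredM ?rpredX //; apply/mxOverP => i3 j3.
  by rewrite mxE rpred_nat.
by apply: rpred_sum => s _; rewrite rpredM ?rpred_sign // rpred_prod.
Qed.

Section MatrixPowers.

Variables (F : fieldType) (n : nat).
Implicit Types M A D W V : 'M[F]_n.

Fact dpow_is_linear k M : linear (dpow k M).
Proof.
move=> a V W; rewrite /dpow scaler_sumr -big_split /=; apply: eq_bigr => i _.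
rewrite mulrDr mulrDl; congr (_ + _).
by rewrite -[LHS]/(_ *m _ *m _) -scalemxAr -scalemxAl.
Qed.

HB.instance Definition _ k M :=
  GRing.isLinear.Build F 'M[F]_n 'M[F]_n *:%R (dpow k M) (dpow_is_linear k M).

Lemma dpow_det_neq0 k M : dpow_det k M != 0 -> forall V, dpow k M V = 0 -> V = 0.
Proof.
rewrite -unitfE -unitmxE => unitL V DV0.
have VL0 : mxvec V *m lin_mx (dpow k M) = 0 by rewrite mul_vec_lin /= DV0 linear0.
by rewrite -[V]mxvecK -(mulmxK unitL (mxvec V)) VL0 mul0mx linear0.
Qed.

Lemma dpow_det1 k : [pchar F] =i pred0 -> (0 < k)%N -> dpow_det k (1%:M : 'M[F]_n) != 0.
Proof.
move=> charF0 k_gt0.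
have -> : dpow_det k (1%:M : 'M[F]_n) = \det (k%:R%:M : 'M[F]_(n * n)).
  congr (\det _); apply/row_matrixP => i; rewrite !rowE mul_rV_lin /=.
  by rewrite (dpow1 k (vec_mx _)) -scaler_nat linearZ /= vec_mxK mul_mx_scalar.
by rewrite det_scalar expf_neq0 // ((pcharf0P F).1 charF0) -lt0n.
Qed.

End MatrixPowers.

Lemma dpow_rank1_contraction (F : fieldType) n k (A D W : 'M[F]_n) (v : 'cV_n) :
  \sum_l dpow k A (v *m row l D) *m W *m delta_mx l 0 =
  \sum_(i < k) \tr (D *m A ^+ (k.-1 - i) *m W) *: (A ^+ i *m v).
Proof.
under eq_bigr do rewrite /dpow !mulmx_suml.
rewrite exchange_big; apply: eq_bigr => i _ /=.
rewrite scaler_suml; apply: eq_bigr => l _.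
rewrite -[_ * _]/(_ *m _ *m _) !mulmxA -!(mulmxA (_ *m v)) -!row_mul -colE.
by rewrite [row _ _]mx11_scalar mul_mx_scalar !mxE.
Qed.

Section PolynomialDifferential.

Variables (F : fieldType) (n : nat) (A D : 'M[F]_n.+1).
Implicit Types (p : {poly F}) (V W : 'M[F]_n.+1).

Definition dhorner p V := \sum_(i < size p) p`_i *: dpow i A V.

Lemma dhorner_commutator p V :
  A * dhorner p V - dhorner p V * A = horner_mx A p * V - V * horner_mx A p.
Proof.
rewrite -[p in horner_mx A p]coefK poly_def rmorph_sum /=.
rewrite mulr_sumr !mulr_suml mulr_sumr -!sumrB; apply: eq_bigr => i _.
rewrite linearZ /= rmorphXn /= horner_mx_X.
by rewrite -!scalerAr -!scalerAl -!scalerBr dpow_commutator.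
Qed.

Lemma comm_dhorner_mxminpoly V : GRing.comm A (dhorner (mxminpoly A) V).
Proof.
apply/eqP; rewrite -subr_eq0 dhorner_commutator mx_root_minpoly.
by rewrite mul0r mulr0 subrr.
Qed.

Definition trace_contraction p W : {poly F} :=
  \sum_(i < size p) p`_i *: \poly_(j < i) \tr (D *m A ^+ (i.-1 - j) *m W).

Lemma size_trace_contraction p W : (size (trace_contraction p W) <= (size p).-1)%N.
Proof.
apply: (leq_trans (size_sum _ _ _)); apply/bigmax_leqP => i _.
apply: (leq_trans (size_scale_leq _ _)); apply: (leq_trans (size_poly _ _)).
by rewrite -ltnS (leq_trans (ltn_ord i)) ?leqSpred.
Qed.

Lemma coef_trace_contraction p W : (1 < size p)%N ->
  (trace_contraction p W)`_(size p).-2 = lead_coef p * \tr (D *m W).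
Proof.
case sz_p: (size p) => [|[|d]] // _; rewrite /trace_contraction coef_sum sz_p.
rewrite big_ord_recr big1 /= => [|i _].
  by rewrite add0r coefZ coef_poly ltnSn subnn mulmx1 lead_coefE sz_p.
by rewrite coefZ coef_poly ltnNge -ltnS ltn_ord mulr0.
Qed.

Lemma dhorner_contraction p W (v : 'cV_n.+1) :
  \sum_l dhorner p (v *m row l D) *m W *m delta_mx l 0 =
  horner_mx A (trace_contraction p W) *m v.
Proof.
rewrite rmorph_sum mulmx_suml /=.
under eq_bigr do rewrite !mulmx_suml.
rewrite exchange_big; apply: eq_bigr => i _ /=.
under eq_bigr do rewrite -!scalemxAl.
rewrite -scaler_sumr dpow_rank1_contraction linearZ /= -scalemxAl; congr (_ *: _).
rewrite poly_def rmorph_sum mulmx_suml; apply: eq_bigr => j _ /=.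
by rewrite linearZ /= rmorphXn /= horner_mx_X scalemxAl.
Qed.

End PolynomialDifferential.

(* Contracting against [D] the endomorphisms commuting with [A := M ^+ k] provided
   by the minimal polynomial of [A], which commute with [M] too, gives a polynomial
   relation between the first powers of [A] with leading coefficient
   [\tr (D *m M)]. *)
Lemma mxtrace_eq0_of_powers (F : fieldType) n k (M D : 'M[F]_n) :
    (forall V, dpow k M V = 0 -> V = 0) ->
    (forall i, \tr (D *m M ^+ (k * i)) = 0) ->
  \tr (D *m M) = 0.
Proof.
case: n => [|n] in M D *; first by rewrite /mxtrace big_ord0.
move=> inj tr0; pose A := M ^+ k; pose p := mxminpoly A.
pose q := trace_contraction A D p.
have q1 : q 1%:M = 0.
  rewrite /q /trace_contraction big1 // => i _; apply/polyP => j.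
  by rewrite coefZ coef_poly mulmx1 -exprM tr0 if_same mulr0 coef0.
have horner_qM : horner_mx A (q M) = 0.
  apply: eq_mx_cV => v; pose Y l := dhorner A p (v *m row l D).
  have MY l : Y l *m M = M *m Y l.
    exact/esym/(comm_of_commX inj)/comm_dhorner_mxminpoly.
  transitivity (M *m (horner_mx A (q 1%:M) *m v)); last first.
    by rewrite q1 rmorph0 !mul0mx mulmx0.
  rewrite -!dhorner_contraction mulmx_sumr; apply: eq_bigr => l _.
  by rewrite -/(Y l) mulmx1 MY mulmxA.
have sz_p : (1 < size p)%N by rewrite size_mxminpoly ltnS mxminpoly_nonconstant.
have qM0 : q M = 0.
  apply/eqP; apply: contraT => q_neq0.
  have := dvdp_leq q_neq0 (mxminpoly_min horner_qM).
  rewrite leqNgt -/p (leq_ltn_trans (size_trace_contraction _ _ _ _)) //.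
  by rewrite prednK // ltnW.
have := coef_trace_contraction A D M sz_p.
by rewrite -/(q M) qM0 coef0 (monicP (mxminpoly_monic A)) mul1r.
Qed.

Section Evaluation.

Variables (T : Type) (R : pzRingType) (x : T).

Definition eval_at (f : T -> R) : R := f x.

Fact eval_at_is_zmod_morphism : zmod_morphism eval_at.
Proof. by []. Qed.

Fact eval_at_is_monoid_morphism : monoid_morphism eval_at.
Proof. by []. Qed.

HB.instance Definition _ :=
  GRing.isZmodMorphism.Build (T -> R) R eval_at eval_at_is_zmod_morphism.
HB.instance Definition _ :=
  GRing.isMonoidMorphism.Build (T -> R) R eval_at eval_at_is_monoid_morphism.

End Evaluation.

Section CharactersOnFiniteIndex.

Variables (G : groupType) (F : fieldType).

Definition mxrep_fct n (rho : mxrep G F n) : 'M[G -> F]_n :=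
  \matrix_(i, j) (fun g => rho g i j).

Lemma map_mxrep_fct n (rho : mxrep G F n) g :
  map_mx (eval_at g) (mxrep_fct rho) = rho g.
Proof. by apply/matrixP => i j; rewrite !mxE. Qed.

Lemma mxrep_fct_mxOver n (rho : mxrep G F n) :
  mxrep_fct rho \is a mxOver repfun.
Proof. by apply/mxOverP => i j; rewrite mxE; apply: repfun_entry. Qed.

Lemma repfun_character n (rho : mxrep G F n) : (fun g => \tr (rho g)) \in repfun.
Proof.
have -> : (fun g => \tr (rho g)) = \tr (mxrep_fct rho).
  by apply/funext => g; rewrite -map_mxrep_fct trace_map_mx.
by apply: rpred_sum => i _; apply/mxOverP/mxrep_fct_mxOver.
Qed.

Lemma repfun_dpow_det n (rho : mxrep G F n) k :
  (fun g => dpow_det k (rho g)) \in repfun.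
Proof.
have -> : (fun g => dpow_det k (rho g)) = dpow_det k (mxrep_fct rho).
  by apply/funext => g; rewrite -map_mxrep_fct map_dpow_det.
exact/rpred_dpow_det/mxrep_fct_mxOver.
Qed.

Lemma eq_characters_on_finite_index n m (rho tau : mxrep G F n) :
    [pchar F] =i pred0 -> (0 < m)%N ->
    (forall g, power_character m rho g = power_character m tau g) ->
  exists H : G -> Prop,
    [/\ subgroup H, finite_index H & forall h, H h -> \tr (rho h) = \tr (tau h)].
Proof.
move=> charF0 m_gt0 eq_pow; pose t := mxrep_dsum rho tau.
pose f g := \tr (rho g) - \tr (tau g); pose h g := dpow_det m (t g).
have Rf : f \in repfun by apply: rpredB; apply: repfun_character.
have fh0 g : f g * h g = 0.
  have [->|/dpow_det_neq0 inj] := eqVneq (h g) 0; first by rewrite mulr0.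
  suff -> : f g = 0 by rewrite mul0r.
  rewrite /f -mxtrace_dsum_sign; apply: mxtrace_eq0_of_powers inj _ => i.
  rewrite mulnC exprM -!mxrepX mxtrace_dsum_sign; apply/eqP.
  by rewrite subr_eq0; apply/eqP/eq_pow.
have h1 : h 1%g != 0 by rewrite /h mxrep1 dpow_det1.
have [H [sgH fiH fH]] := repfun_mul_eq0 Rf (repfun_dpow_det t m) fh0 h1.
by exists H; split=> // x Hx; apply/eqP; rewrite -subr_eq0; apply/eqP/fH.
Qed.

End CharactersOnFiniteIndex.

Theorem theorem2p2 (Gamma : groupType) (F : fieldType) (n : nat)
    (rho1 rho2 : mxrep Gamma F n) :
  [pchar F] =i pred0 -> semisimple rho1 -> semisimple rho2 ->
  potentially_equivalent rho1 rho2 <->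
  exists2 m : nat, (1 <= m)%N &
    forall g : Gamma, power_character m rho1 g = power_character m rho2 g.
Proof.
move=> charF0 ss1 ss2; split=> [[H [sgH fiH [P uP PH]]]|[m m_gt0 eq_pow]].
  have [m m_gt0 Hm] := finite_index_exponent sgH fiH.
  exists m => // g; rewrite /power_character.
  have -> : rho1 (g ^+ m)%g = invmx P *m (rho2 (g ^+ m)%g *m P).
    by rewrite -PH ?mulKmx.
  by rewrite mxtrace_mulC mulmxK.
have [H [sgH fiH trH]] := eq_characters_on_finite_index charF0 m_gt0 eq_pow.
have [K [sgK fiK nK sKH]] := normal_core sgH fiH.
exists K; split=> //.
have [||h /=|P uP Pi] := isomorphic_of_equal_characters charF0
    (rho := restrict sgK rho1) (tau := restrict sgK rho2).
- exact: clifford.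
- exact: clifford.
- exact: trH (sKH _ (subg_ofP h)).
by exists P => // h Kh; apply: (Pi (subg_in sgK Kh)).
Qed.
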